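(* For every integer $n\ge2$, every irregular word $\mathbf{a}=(a_1,\dots,a_n)\in\mathsf{Ir}(n)$ and every $f\in\mathrm{Di}_8$, there exists $\mathbf{b}=(b_1,\dots,b_n)\in\mathsf{R}(n)$ such that \[ f\big[\mathcal{C}_n(\mathbf{a})\big]\subseteq\overline{\mathcal{C}_n(\mathbf{b})}\quad\text{and}\quad\|a_j\|=\|b_j\|\ \text{for all } j\in\{1,\dots,n\}. \]
   Context: $\|z\|:=\max\{|\Re z|,|\Im z|\}$, $\mathscr{D}:=\{a\in\mathbb{Z}[i]:|a|\geq\sqrt2\}$. Let $[z]:=\lfloor \Re z+\tfrac12\rfloor+i\lfloor \Im z+\tfrac12\rfloor$, $\mathfrak{F}:=\{z\in\mathbb{C}:[z]=0\}$, $T(z)=z^{-1}-[z^{-1}]$ ($z\ne0$), $T(0)=0$, Hurwitz partial quotients $a_1(z)=[z^{-1}]$, $a_n(z)=a_1(T^{n-1}z)$. The cylinder of $(a_1,\dots,a_n)\in\mathscr{D}^n$ is $\mathcal{C}_n(a_1,\dots,a_n)=\{z\in\mathfrak{F}:a_j(z)=a_j,1\le j\le n\}$. $\mathsf{R}(n)$ is the set of words whose cylinder has non-empty interior (regular), and $\mathsf{Ir}(n)$ the set of words whose cylinder is non-empty but has empty interior (irregular). $\mathrm{Di}_8$ is the group of isometries of $\mathbb{C}$ generated by $z\mapsto iz$ and $z\mapsto\bar z$. Overline denotes closure. *)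

(* Defs.v *)
From HB Require Import structures.
From mathcomp Require Import all_boot all_order all_algebra.
From mathcomp Require Import complex.
From mathcomp Require Import all_classical all_reals all_analysis.
Set Implicit Arguments.
Unset Strict Implicit.
Unset Printing Implicit Defensive.

Import Order.TTheory GRing.Theory Num.Theory.
Import numFieldNormedType.Exports.
Local Open Scope classical_set_scope.
Local Open Scope complex_scope.
Local Open Scope ring_scope.

(* The complex plane, seen as a numClosedFieldType so that it carries the
   topology of its norm: the radii of balls are elements of R[i] that are
   positive for the partial order of R[i], hence positive reals. *)
Definition Cplx (R : realType) : numClosedFieldType := R[i].

Section HurwitzContinuedFractions.
Variable R : realType.
Local Notation C := (Cplx R).

Implicit Types (z : C) (n : nat).

Definition maxnorm z : R := Num.max `|complex.Re z| `|complex.Im z|.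

Definition gaussian_integer : set C :=
  [set z | (complex.Re z \is a Num.int) && (complex.Im z \is a Num.int)].

Definition digits : set C :=
  gaussian_integer `&` [set a : C | (Num.sqrt 2%:R)%:C <= `|a|].

Definition nearest z : C :=
  (Num.floor (complex.Re z + 2%:R^-1))%:~R +i*
  (Num.floor (complex.Im z + 2%:R^-1))%:~R.

Definition fundamental_domain : set C := [set z | nearest z = 0].

Definition hurwitz_map z : C := if z == 0 then 0 else z^-1 - nearest z^-1.

(* At z = 0, where a_1 is undefined, this takes the value [0^-1] = [0] = 0,
   which is not a digit. *)
Definition first_quotient z : C := nearest z^-1.

(* Numbered from 1, as in a_1, a_2, ... *)
Definition partial_quotient n z : C := first_quotient (iter n.-1 hurwitz_map z).

Definition cylinder n (a : n.-tuple C) : set C :=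
  [set z | fundamental_domain z /\
           forall j : 'I_n, partial_quotient j.+1 z = tnth a j].

Definition words n : set (n.-tuple C) :=
  [set a | forall j : 'I_n, digits (tnth a j)].

Definition regular n : set (n.-tuple C) :=
  [set a | words a /\ interior (cylinder a) !=set0].

Definition irregular n : set (n.-tuple C) :=
  [set a | [/\ words a, cylinder a !=set0 & interior (cylinder a) = set0]].

Definition rotation z : C := 'i * z.

Definition conjugation z : C := z^*.

Inductive Di8 : (C -> C) -> Prop :=
| Di8_rotation : Di8 rotation
| Di8_conjugation : Di8 conjugation
| Di8_id : Di8 idfun
| Di8_comp f g : Di8 f -> Di8 g -> Di8 (f \o g)
| Di8_inv f g : Di8 f -> cancel f g -> cancel g f -> Di8 g.

End HurwitzContinuedFractions.

(* Main.v *)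
Require Import Defs.
From mathcomp Require Import all_boot all_order all_algebra.
From mathcomp Require Import complex.
From mathcomp Require Import all_classical all_reals all_analysis.
From mathcomp Require Import ring lra zify.
Import numFieldNormedType.Exports.
Import Order.TTheory GRing.Theory Num.Theory.
Local Open Scope classical_set_scope.
Local Open Scope ring_scope.
Set Implicit Arguments.
Unset Strict Implicit.

(* The points reachable after some digits form, up to boundary, the square
   minus unit disks centred at a set Q of nonzero Gaussian integers. Under
   w = 1/z a unit c in Q turns into the half-plane Re (c w) <= 1/2, a c with
   |c|^2 = 2 into the outside of the unit disk at conj c, and the square into
   the outside of the unit disks at the four units; farther c do not matter.
   If the tile of the next digit d lies on the right side of all these
   half-planes, translating by -d gives a region of the same kind, which is
   star-shaped with respect to an interior point shifted towards d, hence is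
   the closure of its interior. Otherwise the tile meets the half-plane only in
   an edge. Then d is replaced by d - conj c, which has the same max-norm and
   carries this edge to its mirror image, and the remaining digits are
   reflected accordingly. Closed cylinders are equivariant under Di_8, so that
   f can be absorbed into the word beforehand. *)

Local Notation Re := complex.Re.
Local Notation Im := complex.Im.

(* A pair of integers (m, k) stands for the Gaussian integer m + ik. *)
Definition sqnorm (c : int * int) : int := c.1 ^+ 2 + c.2 ^+ 2.
Definition is_digit (c : int * int) : bool := 2 <= sqnorm c.
Definition nrm (c : int * int) : nat := maxn `|c.1|%N `|c.2|%N.

(** * Gaussian integers by norm: 1, 2, or more *)

Lemma sqnorm1P (c : int * int) : sqnorm c = 1 ->
  [\/ c = (1, 0), c = (-1, 0), c = (0, 1) | c = (0, -1)].
Proof.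
case: c => m k; rewrite /sqnorm /= => h.
have [hm hk] : (m = -1 \/ m = 0 \/ m = 1) /\ (k = -1 \/ k = 0 \/ k = 1).
  by split; nia.
by case: hm h => [->|[->|->]]; case: hk => [->|[->|->]] // _;
  [apply: Or42|apply: Or44|apply: Or43|apply: Or41].
Qed.

Lemma sqnorm2P (c : int * int) : sqnorm c = 2 ->
  [\/ c = (1, 1), c = (-1, 1), c = (1, -1) | c = (-1, -1)].
Proof.
case: c => m k; rewrite /sqnorm /= => h.
have [hm hk] : (m = -1 \/ m = 0 \/ m = 1) /\ (k = -1 \/ k = 0 \/ k = 1).
  by split; nia.
by case: hm h => [->|[->|->]]; case: hk => [->|[->|->]] // _;
  [apply: Or44|apply: Or42|apply: Or43|apply: Or41].
Qed.

Lemma sqnorm_gt2 (c : int * int) : 2 < sqnorm c ->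
  [\/ 2 <= c.1, c.1 <= -2, 2 <= c.2 | c.2 <= -2].
Proof.
case: c => m k; rewrite /sqnorm /= => h.
case: (lerP 2 m) => h1; first exact: Or41.
case: (lerP m (-2)) => h2; first exact: Or42.
case: (lerP 2 k) => h3; first exact: Or43.
by apply: Or44; nia.
Qed.

Lemma sqnorm_cases (c : int * int) : c != (0, 0) ->
  [\/ sqnorm c = 1, sqnorm c = 2 | 2 < sqnorm c].
Proof.
case: c => m k; rewrite /sqnorm xpair_eqE /= => h.
have h0 : 0 < m ^+ 2 + k ^+ 2 by nia.
have [h1|[h1|h1]] : m ^+ 2 + k ^+ 2 = 1 \/ m ^+ 2 + k ^+ 2 = 2 \/ 2 < m ^+ 2 + k ^+ 2.
- by lia.
- exact: Or31.
- exact: Or32.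
- exact: Or33.
Qed.

(** * Unit disks under inversion *)

Section Geometry.
Variable R : realType.
Local Notation C := (Cplx R).
Implicit Types (z w p : C) (c d : int * int) (Q : set (int * int)).
Implicit Types (ds es : seq (int * int)).

Definition gauss c : C := (c.1%:~R +i* c.2%:~R)%C.

Lemma complex_eq z w : Re z = Re w -> Im z = Im w -> z = w.
Proof. by case: z => x y; case: w => u v /= -> ->. Qed.

Lemma re_add z w : Re (z + w) = Re z + Re w.
Proof. by case: z => x y; case: w. Qed.
Lemma im_add z w : Im (z + w) = Im z + Im w.
Proof. by case: z => x y; case: w. Qed.
Lemma re_sub z w : Re (z - w) = Re z - Re w.
Proof. by case: z => x y; case: w. Qed.
Lemma im_sub z w : Im (z - w) = Im z - Im w.
Proof. by case: z => x y; case: w. Qed.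
Lemma re_inv z : Re z^-1 = Re z / (Re z ^+ 2 + Im z ^+ 2).
Proof. by case: z. Qed.
Lemma im_inv z : Im z^-1 = - (Im z / (Re z ^+ 2 + Im z ^+ 2)).
Proof. by case: z. Qed.

Definition reimE := (re_sub, im_sub, re_add, im_add).

Lemma sqr_gt0 z : z != 0 -> 0 < Re z ^+ 2 + Im z ^+ 2.
Proof.
case: z => x y z0 /=; rewrite lt_neqAle addr_ge0 ?sqr_ge0// andbT eq_sym.
apply: contra z0; rewrite paddr_eq0 ?sqr_ge0// !sqrf_eq0.
by move=> /andP[/eqP-> /eqP->].
Qed.

Definition closed_square : set C :=
  [set z | (- 2^-1 <= Re z <= 2^-1) /\ (- 2^-1 <= Im z <= 2^-1)].

Definition open_square : set C :=
  [set z | (- 2^-1 < Re z < 2^-1) /\ (- 2^-1 < Im z < 2^-1)].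

Lemma open_square_closed z : open_square z -> closed_square z.
Proof. by move=> -[? ?]; split; lra. Qed.

Definition sqdist c z : R := (Re z - c.1%:~R) ^+ 2 + (Im z - c.2%:~R) ^+ 2.

Definition off Q : set C := [set z | forall c, Q c -> 1 <= sqdist c z].
Definition strictly_off Q : set C := [set z | forall c, Q c -> 1 < sqdist c z].

Lemma intr_sqnorm c : (sqnorm c)%:~R = c.1%:~R ^+ 2 + c.2%:~R ^+ 2 :> R.
Proof. by rewrite /sqnorm rmorphD !rmorphXn. Qed.

(** Let w = 1/z. As |c| = 1, the left side is |z|^2 - 2 Re (conj c z), and Re (conj c z) = |z|^2 Re
    (c w). *)
Lemma sqdist_unit c z : z != 0 -> sqnorm c = 1 ->
  sqdist c z - 1 = (Re z ^+ 2 + Im z ^+ 2) *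
    (1 - 2 * (Re z^-1 * c.1%:~R - Im z^-1 * c.2%:~R)).
Proof.
move=> /sqr_gt0 N0 /(congr1 (fun m : int => m%:~R : R)).
rewrite /= intr_sqnorm /sqdist re_inv im_inv => h.
transitivity (Re z ^+ 2 + Im z ^+ 2 - 2 * (Re z * c.1%:~R + Im z * c.2%:~R) +
  (c.1%:~R ^+ 2 + c.2%:~R ^+ 2) - 1); first by ring.
by rewrite h; field; rewrite gt_eqF.
Qed.

(** The origin has power |c|^2 - 1 = 1 with respect to the unit circle at c, so z |-> 1/z carries
    this circle to its complex conjugate. *)
Lemma sqdist_diag c z : z != 0 -> sqnorm c = 2 ->
  sqdist c z - 1 = (Re z ^+ 2 + Im z ^+ 2) * (sqdist (c.1, - c.2) z^-1 - 1).
Proof.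
move=> /sqr_gt0 N0 /(congr1 (fun m : int => m%:~R : R)).
rewrite /= intr_sqnorm /sqdist re_inv im_inv => h.
transitivity (Re z ^+ 2 + Im z ^+ 2 - 2 * (Re z * c.1%:~R + Im z * c.2%:~R) +
  (c.1%:~R ^+ 2 + c.2%:~R ^+ 2) - 1); first by ring.
rewrite h; transitivity ((Re z ^+ 2 + Im z ^+ 2) *
  ((Re z ^+ 2 + Im z ^+ 2)^-1 - 2 * (Re z * c.1%:~R + Im z * c.2%:~R) /
   (Re z ^+ 2 + Im z ^+ 2) + (c.1%:~R ^+ 2 + c.2%:~R ^+ 2) - 1)).
  by rewrite h; field; rewrite gt_eqF.
by rewrite rmorphN /=; field; rewrite gt_eqF.
Qed.

Lemma le_sqdist_unit c z : z != 0 -> sqnorm c = 1 ->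
  (1 <= sqdist c z) = (Re z^-1 * c.1%:~R - Im z^-1 * c.2%:~R <= 2^-1).
Proof.
move=> z0 h; rewrite -subr_ge0 sqdist_unit// pmulr_rge0 ?sqr_gt0//.
by apply/idP/idP => ?; lra.
Qed.

Lemma lt_sqdist_unit c z : z != 0 -> sqnorm c = 1 ->
  (1 < sqdist c z) = (Re z^-1 * c.1%:~R - Im z^-1 * c.2%:~R < 2^-1).
Proof.
move=> z0 h; rewrite -subr_gt0 sqdist_unit// pmulr_rgt0 ?sqr_gt0//.
by apply/idP/idP => ?; lra.
Qed.

Lemma le_sqdist_diag c z : z != 0 -> sqnorm c = 2 ->
  (1 <= sqdist c z) = (1 <= sqdist (c.1, - c.2) z^-1).
Proof.
by move=> z0 h; rewrite -subr_ge0 sqdist_diag// pmulr_rge0 ?sqr_gt0// subr_ge0.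
Qed.

Lemma lt_sqdist_diag c z : z != 0 -> sqnorm c = 2 ->
  (1 < sqdist c z) = (1 < sqdist (c.1, - c.2) z^-1).
Proof.
by move=> z0 h; rewrite -subr_gt0 sqdist_diag// pmulr_rgt0 ?sqr_gt0// subr_gt0.
Qed.

Lemma lt_sqdist_far c z : closed_square z -> 2 < sqnorm c -> 1 < sqdist c z.
Proof.
rewrite /sqdist; move=> [hx hy] /sqnorm_gt2[] h.
- have : 2%:~R <= c.1%:~R :> R by rewrite ler_int.
  by have := sqr_ge0 (Im z - c.2%:~R); nra.
- have : c.1%:~R <= (-2)%:~R :> R by rewrite ler_int.
  by have := sqr_ge0 (Im z - c.2%:~R); nra.
- have : 2%:~R <= c.2%:~R :> R by rewrite ler_int.
  by have := sqr_ge0 (Re z - c.1%:~R); nra.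
- have : c.2%:~R <= (-2)%:~R :> R by rewrite ler_int.
  by have := sqr_ge0 (Re z - c.1%:~R); nra.
Qed.

Lemma off_unit_inv z c : closed_square z -> z != 0 -> sqnorm c = 1 ->
  1 <= sqdist c z^-1.
Proof.
move=> [hx hy] z0 h; rewrite le_sqdist_unit ?invr_eq0// invrK.
by case: (sqnorm1P h) => -> /=; lra.
Qed.

Lemma open_squareV z : z != 0 ->
  (forall c, sqnorm c = 1 -> 1 < sqdist c z) -> open_square z^-1.
Proof.
move=> z0 h.
have := h (1, 0) erefl; have := h (-1, 0) erefl.
have := h (0, 1) erefl; have := h (0, -1) erefl.
by rewrite !lt_sqdist_unit //= => ????; split; lra.
Qed.

(** Here e = c + d is the centre before the translation by -d: a unit, coming from the square, or
    the conjugate of a centre of norm 2 in Q. Units of Q become half-planes and leave no centre;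
    [open_sides] deals with them. *)
Definition next_centers Q d : set (int * int) :=
  [set c | let e := (c.1 + d.1, c.2 + d.2) in
           sqnorm e = 1 \/ sqnorm e = 2 /\ Q (e.1, - e.2)].

Lemma sqdist_shift c d w :
  sqdist c (w - gauss d) = sqdist (c.1 + d.1, c.2 + d.2) w.
Proof.
by rewrite /sqdist !reimE !rmorphD /= /gauss /=; congr (_ ^+ 2 + _ ^+ 2); ring.
Qed.

Lemma next_off Q d z : closed_square z -> z != 0 -> off Q z ->
  off (next_centers Q d) (z^-1 - gauss d).
Proof.
move=> zF z0 zQ c; rewrite /next_centers /= sqdist_shift => -[|[]] h.
  exact: off_unit_inv.
by move=> /zQ; rewrite le_sqdist_diag /= ?opprK// /sqnorm /= sqrrN.
Qed.

(* The tile of d lies in the half-plane Re (c w) <= 1/2 of every unit c in Q. *)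
Definition open_sides Q d : Prop :=
  forall c, Q c -> sqnorm c = 1 -> c.1 * d.1 - c.2 * d.2 <= 0.

Lemma gauss_add_neq0 d w : is_digit d -> closed_square w -> w + gauss d != 0.
Proof.
rewrite /is_digit => hd [hx hy]; apply/eqP => /(congr1 (fun z => (Re z, Im z))).
rewrite !reimE /= => -[h1 h2].
have : 2%:~R <= (sqnorm d)%:~R :> R by rewrite ler_int.
by rewrite intr_sqnorm; nra.
Qed.

(** A converse of [next_off] for open regions: the units e yield the square, the other e the centres
    of norm 2 in Q, and [open_sides] the units in Q. *)
Lemma strictly_off_next Q d w : is_digit d -> ~ Q (0, 0) -> open_sides Q d ->
  open_square w -> strictly_off (next_centers Q d) w ->
  open_square (w + gauss d)^-1 /\ strictly_off Q (w + gauss d)^-1.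
Proof.
move=> hd Q0 hQ wF wN.
have wd0 := gauss_add_neq0 hd (open_square_closed wF).
set z := w + gauss d in wd0 *.
have wN' e : sqnorm e = 1 \/ sqnorm e = 2 /\ Q (e.1, - e.2) -> 1 < sqdist e z.
  move=> he; have := wN (e.1 - d.1, e.2 - d.2).
  rewrite /next_centers -[w](addrK (gauss d)) sqdist_shift /= !subrK.
  by case: e he => e1 e2 /= he; apply.
have zF : open_square z^-1 by apply: open_squareV => // c hc; apply: wN'; left.
split=> // c Qc.
have /sqnorm_cases[] : c != (0, 0) by apply: contra_notN Q0 => /eqP <-.
- move=> c1; rewrite lt_sqdist_unit ?invr_eq0// invrK.
  (* Re (c d) <= 0, while Re (c w) < 1/2 on the open square. *)
  have : (c.1 * d.1 - c.2 * d.2)%:~R <= 0%:~R :> R by rewrite ler_int hQ.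
  rewrite rmorphB !rmorphM /= !reimE /=.
  by case: wF => ??; case: (sqnorm1P c1) => -> /=; lra.
- move=> c2; rewrite lt_sqdist_diag ?invr_eq0// invrK; apply: wN'.
  by right; rewrite opprK /sqnorm sqrrN; case: (c) Qc c2.
- exact/lt_sqdist_far/open_square_closed.
Qed.

(** * Star centres *)

Lemma diag_dot (u v a b : R) : 2^-1 <= u -> 2^-1 <= v ->
  1 <= a -> 1 <= b -> 1 <= u * a + v * b.
Proof. by move=> hu hv ha hb; nra. Qed.

(** The circle and |v| <= 1/2 give u >= sqrt 3 / 2 > 6/7, and 6/7 * 7/5 - 1/2 * 2/5 = 1. *)
Lemma unit_dot (u v a b : R) : 2^-1 <= u -> - 2^-1 <= v <= 2^-1 ->
  1 <= u ^+ 2 + v ^+ 2 -> 7/5 <= a -> - (2/5) <= b <= 2/5 ->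
  1 <= u * a + v * b.
Proof.
move=> hu /andP[hv1 hv2] h ha /andP[hb1 hb2].
have v2 : v ^+ 2 <= 4^-1.
  have : 0 <= (v + 2^-1) * (2^-1 - v) by apply: mulr_ge0; lra.
  by lra.
have u7 : 6/7 <= u.
  rewrite leNgt; apply/negP => u7.
  have : 0 <= (u - 2^-1) * (6/7 - u) by apply: mulr_ge0; lra.
  by lra.
have : 0 <= (v + 2^-1) * (2/5 + b) by apply: mulr_ge0; lra.
have : 0 <= (2^-1 - v) * (2/5 - b) by apply: mulr_ge0; lra.
have : 0 <= (u - 6/7) * (a - 7/5) by apply: mulr_ge0; lra.
by lra.
Qed.

Lemma far_dot (u v a b : R) : 3/2 <= u -> 3/2 <= a -> - 4^-1 <= v * b ->
  1 <= u * a + v * b.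
Proof. by move=> hu ha hb; nra. Qed.

(** For k = 0 both factors are at most 1/2 in absolute value; otherwise they have the same sign. *)
Lemma coord_mul_ge (k : int) (y q : R) : - 2^-1 <= y <= 2^-1 ->
  - 2^-1 <= q <= 2^-1 -> - 4^-1 <= (y - k%:~R) * (q - k%:~R).
Proof.
move=> hy hq; have [k0|[k1|k1]] : k = 0 \/ 1 <= k \/ k <= -1 by lia.
- by rewrite k0; nra.
- have : 1%:~R <= k%:~R :> R by rewrite ler_int.
  move=> h; have : 0 <= (k%:~R - y) * (k%:~R - q) by apply: mulr_ge0; lra.
  by lra.
- have : k%:~R <= (-1)%:~R :> R by rewrite ler_int.
  move=> h; have : 0 <= (y - k%:~R) * (q - k%:~R) by apply: mulr_ge0; lra.
  by lra.
Qed.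

Definition dot c z p : R := (Re z - c.1%:~R) * (Re p - c.1%:~R) +
  (Im z - c.2%:~R) * (Im p - c.2%:~R).

Lemma dot_far c z p : closed_square z -> closed_square p -> 2 < sqnorm c ->
  1 <= dot c z p.
Proof.
rewrite /dot => -[zx zy] [px py] /sqnorm_gt2[] h.
- have : 2%:~R <= c.1%:~R :> R by rewrite ler_int.
  by move=> h'; rewrite -mulrNN; apply: far_dot; rewrite ?coord_mul_ge//; lra.
- have : c.1%:~R <= (-2)%:~R :> R by rewrite ler_int.
  by move=> h'; apply: far_dot; rewrite ?coord_mul_ge//; lra.
- have : 2%:~R <= c.2%:~R :> R by rewrite ler_int.
  by move=> h'; rewrite addrC -mulrNN; apply: far_dot; rewrite ?coord_mul_ge//; lra.
- have : c.2%:~R <= (-2)%:~R :> R by rewrite ler_int.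
  by move=> h'; rewrite addrC; apply: far_dot; rewrite ?coord_mul_ge//; lra.
Qed.

(* The dot product condition makes the outside of each disk star-shaped with
   respect to p: on the segment from z to p the squared distance to c is the
   combination bounded in dist_segment. *)
Definition star_center Q p : Prop := open_square p /\
  forall c, Q c -> 1 < sqdist c p /\
    forall z, closed_square z -> 1 <= sqdist c z -> 1 <= dot c z p.

(** The shift 2/5 stays below 1/2, yet suffices for [unit_dot], where 7/5 = 1 + 2/5. *)
Definition toward (m : int) : R := 2/5 * (sgz m)%:~R.

Lemma toward_cases m :
  [\/ m = 0 /\ toward m = 0, 0 < m /\ toward m = 2/5
    | m < 0 /\ toward m = - (2/5)].
Proof.
rewrite /toward; case: sgzP => h; [apply: Or31|apply: Or32|apply: Or33];
by rewrite ?h; split=> //; lra.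
Qed.

(** A centre c satisfies |c + d|^2 <= 2 <= |d|^2, so it lies on the side of 0 opposite to d, and
    shifting the point from 0 towards d moves it away from the near disks. *)
Lemma next_star_center Q d : is_digit d -> ~ next_centers Q d (0, 0) ->
  star_center (next_centers Q d) (toward d.1 +i* toward d.2)%C.
Proof.
move=> hd N0.
have tb m : - (2/5) <= toward m <= 2/5.
  by case: (toward_cases m) => -[_ ->]; lra.
have tpos m : 0 < m -> toward m = 2/5.
  by move=> m0; case: (toward_cases m) => -[] //; lia.
have tneg m : m < 0 -> toward m = - (2/5).
  by move=> m0; case: (toward_cases m) => -[] //; lia.
have tge m : 0 <= m -> 0 <= toward m.
  by move=> m0; case: (toward_cases m) => -[] // *; (lia || lra).
have tle m : m <= 0 -> toward m <= 0.
  by move=> m0; case: (toward_cases m) => -[] // *; (lia || lra).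
have pF : open_square (toward d.1 +i* toward d.2)%C.
  by have := tb d.1; have := tb d.2; split=> /=; lra.
split=> // c Nc.
have /sqnorm_cases c3 : c != (0, 0) by apply: contra_notN N0 => /eqP <-.
have cd : sqnorm (c.1 + d.1, c.2 + d.2) = 1 \/ sqnorm (c.1 + d.1, c.2 + d.2) = 2.
  by case: Nc => [|[]]; [left|right].
move: cd hd; rewrite /is_digit {1 2}/sqnorm /= => cd hd.
have hb1 := tb d.1; have hb2 := tb d.2.
case: c3 => hc; last first.
- split; first exact: lt_sqdist_far (open_square_closed pF) hc.
  by move=> z zF _; apply: dot_far => //; exact: open_square_closed.
(* Both coordinates of c + d are at most 1 in absolute value, so no coordinate of d has the sign of
   that of c. *)
- have [h1 h2] : 0 <= - c.1 * d.1 /\ 0 <= - c.2 * d.2.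
    by case: (sqnorm2P hc) cd => -> /=; rewrite /sqnorm in hd; nia.
  rewrite /dot /sqdist /=; case: (sqnorm2P hc) h1 h2 => -> /= h1 h2.
  + have := tle d.1 ltac:(lia); have := tle d.2 ltac:(lia).
    split; first by nra.
    move=> z [??] _; rewrite -mulrNN -[X in _ + X]mulrNN.
    by apply: diag_dot; lra.
  + have := tge d.1 ltac:(lia); have := tle d.2 ltac:(lia).
    split; first by nra.
    move=> z [??] _; rewrite -[X in _ + X]mulrNN.
    by apply: diag_dot; lra.
  + have := tle d.1 ltac:(lia); have := tge d.2 ltac:(lia).
    split; first by nra.
    move=> z [??] _; rewrite -mulrNN.
    by apply: diag_dot; lra.
  + have := tge d.1 ltac:(lia); have := tge d.2 ltac:(lia).
    split; first by nra.
    move=> z [??] _.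
    by apply: diag_dot; lra.
- rewrite /dot /sqdist /=; case: (sqnorm1P hc) cd => -> /= cd.
  + have h1 : d.1 < 0 by rewrite /sqnorm in hd; nia.
    rewrite (tneg _ h1); split; first by nra.
    move=> z [??] h; rewrite -mulrNN; apply: unit_dot; lra.
  + have h1 : 0 < d.1 by rewrite /sqnorm in hd; nia.
    rewrite (tpos _ h1); split; first by nra.
    move=> z [??] h; apply: unit_dot; lra.
  + have h1 : d.2 < 0 by rewrite /sqnorm in hd; nia.
    rewrite (tneg _ h1); split; first by nra.
    move=> z [??] h; rewrite addrC -mulrNN; apply: unit_dot; lra.
  + have h1 : 0 < d.2 by rewrite /sqnorm in hd; nia.
    rewrite (tpos _ h1); split; first by nra.
    move=> z [??] h; rewrite addrC; apply: unit_dot; lra.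
Qed.

End Geometry.

(** * Closures along segments; closed and open cylinders *)

Section Cylinders.
Variable R : realType.
Local Notation C := (Cplx R).
Implicit Types (z w p : C) (c d : int * int) (Q : set (int * int)).
Implicit Types (ds es : seq (int * int)).

Lemma closure_image (f : C -> C) (S S' : set C) z : {for z, continuous f} ->
  (forall s, S s -> S' (f s)) -> closure S z -> closure S' (f z).
Proof.
move=> fz SS' Sz B nB; have [s [Ss Bs]] := Sz (f @^-1` B) (fz _ nB).
by exists (f s); split=> //; exact: SS'.
Qed.

Lemma closure_unit_interval :
  closure ((fun r : R => (r%:C)%C : C) @` [set r : R | 0 < r <= 1]) 0.
Proof.
move=> B /nbhs_ballP[e e0 eB].
(* A radius that is positive in the order of [R[i]] is a positive real. *)
have [e1 ee] : 0 < Re e /\ Im e = 0.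
  by move: e0; rewrite /= ltcE /= => /andP[/eqP-> ->].
exists ((Num.min (Re e / 2) 1)%:C)%C; split.
  by exists (Num.min (Re e / 2) 1) => //=; rewrite ge_min lexx orbT lt_min; lra.
apply: eB; rewrite /ball /= sub0r normrN.
rewrite ltcE /= ee eqxx /= expr0n addr0 sqrtr_sqr ger0_norm ?le_min; last by lra.
by rewrite gt_min; lra.
Qed.

(** Here a, b, e stand for |z - c|^2, the dot product and |p - c|^2; the weights add up to 1. *)
Lemma dist_segment (t a b e : R) : 0 < t <= 1 -> 1 <= a -> 1 <= b -> 1 < e ->
  1 < (1 - t) ^+ 2 * a + 2 * t * (1 - t) * b + t ^+ 2 * e.
Proof.
move=> /andP[t0 t1] ha hb he.
have : 0 <= (1 - t) ^+ 2 * (a - 1) by apply: mulr_ge0; [exact: sqr_ge0|lra].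
have : 0 <= (t * (1 - t)) * (b - 1).
  by rewrite !mulr_ge0//; lra.
have : 0 < t ^+ 2 * (e - 1) by rewrite mulr_gt0 ?exprn_gt0//; lra.
by lra.
Qed.

(** The points of the segment from z to p, except possibly z, lie in the open region and tend to
    z. *)
Lemma star_closure Q p z : star_center Q p -> closed_square z -> off Q z ->
  closure (@open_square R `&` strictly_off Q) z.
Proof.
move=> [[px py] pQ] zF zQ.
pose F (t : C) : C := z + t * (p - z).
have F0 : F 0 = z by rewrite /F mul0r addr0.
have cF : {for 0, continuous F}.
  apply: (@continuousD _ _ _ (fun=> z) (fun t : C => t * (p - z))).
    exact: (@cst_continuous C C z 0).
  apply: (@continuousM _ _ (fun t : C => t) (fun=> p - z)); first by move=> B.
  exact: (@cst_continuous C C (p - z) 0).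
rewrite -F0; apply: closure_image cF _ closure_unit_interval.
move=> _ [r /= r01 <-].
have xE : Re (z + (r%:C)%C * (p - z)) = (1 - r) * Re z + r * Re p.
  by case: (z) (p) => x y [u v] /=; ring.
have yE : Im (z + (r%:C)%C * (p - z)) = (1 - r) * Im z + r * Im p.
  by case: (z) (p) => x y [u v] /=; ring.
rewrite /F; split.
  case: zF => hx hy.
  rewrite /open_square /= xE yE; split; nra.
move=> c Qc; have [cp cz] := pQ _ Qc.
have := dist_segment r01 (zQ _ Qc) (cz _ zF (zQ _ Qc)) cp.
rewrite /sqdist /dot xE yE; congr (_ < _); ring.
Qed.

(* Unlike cylinder, insensitive to the tie-breaking of nearest, hence
   equivariant under the isometries of the square. *)
Fixpoint closed_cylinder ds : set C :=
  if ds is d :: ds' then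
    [set z | [/\ closed_square z, z != 0 & closed_cylinder ds' (z^-1 - gauss R d)]]
  else @closed_square R.

(** On this open version no tie of [nearest] occurs, so its points do have the quotients [ds]. *)
Fixpoint open_cylinder ds : set C :=
  if ds is d :: ds' then
    [set z | [/\ open_square z, z != 0 & open_cylinder ds' (z^-1 - gauss R d)]]
  else @open_square R.

Lemma closed_cylinder_square ds z : closed_cylinder ds z -> closed_square z.
Proof. by case: ds => [|d ds] // []. Qed.

Lemma open_cylinder_square ds z : open_cylinder ds z -> open_square z.
Proof. by case: ds => [|d ds] // []. Qed.

Lemma norm_coord z (e : C) : `|z| < e -> `|Re z| < Re e /\ `|Im z| < Re e.
Proof.
move=> ze; have : `|z| = (Num.sqrt (Re z ^+ 2 + Im z ^+ 2))%:C%C by case: (z).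
move: ze => /[swap] ->; rewrite ltcE /= => /andP[_ h].
split; apply: le_lt_trans h; rewrite -sqrtr_sqr; apply: ler_wsqrtr.
  by rewrite lerDl sqr_ge0.
by rewrite lerDr sqr_ge0.
Qed.

Lemma open_square_nbhs z : open_square z -> nbhs z (@open_square R).
Proof.
move=> [zx zy]; apply/nbhs_ballP.
pose r := Num.min (2^-1 - `|Re z|) (2^-1 - `|Im z|).
have r0 : 0 < r by rewrite lt_min !subr_gt0 !ltr_norml zx zy.
have rx : r <= 2^-1 - `|Re z| by rewrite ge_min lexx.
have ry : r <= 2^-1 - `|Im z| by rewrite ge_min lexx orbT.
exists (r%:C)%C; first by rewrite /= ltcE /= eqxx.
move=> w /norm_coord; rewrite !reimE /= => -[hx hy].
split; rewrite -ltr_norml.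
  by have := ler_normB (Re z) (Re z - Re w); rewrite subKr; lra.
by have := ler_normB (Im z) (Im z - Im w); rewrite subKr; lra.
Qed.

Lemma open_cylinder_nbhs ds z : open_cylinder ds z -> nbhs z (open_cylinder ds).
Proof.
elim: ds z => [|d ds IH] z /=; first exact: open_square_nbhs.
move=> [zF z0 /IH zd].
have cz : {for z, continuous (fun x : C => x^-1 - gauss R d)}.
  apply: (@continuousB _ _ _ (fun x : C => x^-1) (fun=> gauss R d)).
    exact: inv_continuous.
  exact: (@cst_continuous C C (gauss R d) z).
have n0 : nbhs z [set x : C | x != 0].
  apply/nbhs_ballP; exists `|z|; first by rewrite /= normr_gt0.
  by move=> w; rewrite /ball /=; apply: contraTneq => ->; rewrite subr0 ltxx.
near=> x; split.
- by near: x; exact: open_square_nbhs.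
- by near: x.
- by near: x; exact: cz _ zd.
Unshelve. all: by end_near. Qed.

(** * The action of Di_8 on digits and cylinders *)

(** Normal form of the elements of Di_8: an optional exchange of the coordinates, then two signs. *)
Definition flip (w s t : bool) z : C :=
  let z' := if w then (Im z +i* Re z)%C else z in
  Complex ((-1) ^+ s * Re z') ((-1) ^+ t * Im z').

Definition flip_digit (w s t : bool) d : int * int :=
  let d' := if w then (d.2, d.1) else d in
  ((-1) ^+ s * d'.1, (-1) ^+ t * d'.2).

Lemma nrm_flip (w s t : bool) d : nrm (flip_digit w s t d) = nrm d.
Proof.
rewrite /nrm /flip_digit /= !abszM !abszX !exp1n !mul1n.
by case: w; rewrite // maxnC.
Qed.

Lemma digit_flip (w s t : bool) d : is_digit (flip_digit w s t d) = is_digit d.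
Proof.
rewrite /is_digit /sqnorm /= !exprMn !sqrr_sign !mul1r.
by case: w; rewrite //= addrC.
Qed.

Lemma flipB (w s t : bool) y z : flip w s t (y - z) = flip w s t y - flip w s t z.
Proof.
by apply: complex_eq; case: w; rewrite !reimE /flip /= !reimE -mulrBr.
Qed.

Lemma flip_gauss (w s t : bool) d : flip w s t (gauss R d) = gauss R (flip_digit w s t d).
Proof.
by apply: complex_eq; case: w; rewrite /flip /= rmorphM rmorph_sign.
Qed.

Lemma flip_eq0 (w s t : bool) z : (flip w s t z == 0) = (z == 0).
Proof.
case: z => x y; case: w => /=; rewrite /flip /= !eq_complex /= !mulf_eq0 !signr_eq0 //.
by rewrite andbC.
Qed.

Lemma flip_square (w s t : bool) z : closed_square z -> closed_square (flip w s t z).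
Proof.
by move=> [hx hy]; case: w s t => -[] []; split; rewrite /flip /= ?expr0 ?expr1; lra.
Qed.

(* Inversion conjugates an isometry by z |-> z^*, which turns the quarter-turn
   z |-> iz into z |-> -iz. *)
Lemma flipV (w s t : bool) z : (flip w s t z)^-1 = flip w (s (+) w) (t (+) w) z^-1.
Proof.
have sqE (x y : R) :
    ((-1) ^+ s * x) ^+ 2 + ((-1) ^+ t * y) ^+ 2 = x ^+ 2 + y ^+ 2.
  by rewrite !exprMn !sqrr_sign !mul1r.
by apply: complex_eq; case: w; rewrite (re_inv, im_inv) /flip /= sqE (re_inv, im_inv)
  ?addbF ?addbT ?signrN ?mulrNN ?mulrN ?mulNr mulrA // [Im z ^+ 2 + _]addrC.
Qed.

(** By [flipV] the first digit and the tail both undergo the isometry conjugated by z |-> z^*; hence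
    the induction over all isometries. *)
Lemma closed_cylinder_flip ds (w s t : bool) : exists es,
  [/\ map nrm es = map nrm ds, all is_digit es = all is_digit ds &
    forall z, closed_cylinder ds z -> closed_cylinder es (flip w s t z)].
Proof.
elim: ds w s t => [|d ds IH] w s t.
  by exists [::]; split=> // z; exact: flip_square.
have [es [n_es d_es c_es]] := IH w (s (+) w) (t (+) w).
exists (flip_digit w (s (+) w) (t (+) w) d :: es); split=> /=.
- by rewrite nrm_flip n_es.
- by rewrite digit_flip d_es.
- move=> z [zF z0 zd]; split; first exact: flip_square.
    by rewrite flip_eq0.
  by rewrite flipV -flip_gauss -flipB; exact: c_es.
Qed.

Lemma Di8_flip (f : C -> C) : Di8 f -> exists w s t : bool, f =1 flip w s t.
Proof.
elim=> {f}.
- exists true, true, false => z; rewrite /rotation -complexiE.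
  by case: z => x y; rewrite /flip /=; simpc.
- exists false, false, true => z; rewrite /conjugation /flip.
  by case: z => x y; rewrite /= mulN1r mul1r.
- by exists false, false, false => -[x y]; rewrite /flip /= !mul1r.
- move=> f g _ [w [s [t fE]]] _ [w' [s' [t' gE]]].
  (* An outer exchange of coordinates permutes the inner signs. *)
  exists (w (+) w'), (s (+) if w then t' else s'), (t (+) if w then s' else t') => z.
  rewrite /= gE fE /flip; case: w {fE} => /=; case: w' {gE} => /=;
  by rewrite !signr_addb !mulrA.
- move=> f g _ [w [s [t fE]]] fK gK.
  exists w, (if w then t else s), (if w then s else t) => z.
  rewrite -{2}[z]gK fE /flip; case: (g z) => x y.
  by case: w {fE} => /=; rewrite !mulrA -!signr_addb !addbb !mul1r.
Qed.

End Cylinders.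

(** * Dodging thin tiles and building the new word *)

Section Words.
Variable R : realType.
Local Notation C := (Cplx R).
Implicit Types (z w p : C) (c d : int * int) (Q : set (int * int)).
Implicit Types (ds es : seq (int * int)).

(** This is Re (c d). *)
Definition side c d : int := c.1 * d.1 - c.2 * d.2.

Lemma side_ge c z : sqnorm c = 1 -> closed_square z ->
  - 2^-1 <= Re z * c.1%:~R - Im z * c.2%:~R.
Proof. by move=> c1 [hx hy]; case: (sqnorm1P c1) => -> /=; lra. Qed.

(* A tile on the far side of the line Re (c w) = 1/2 meets the region
   Re (c w) <= 1/2 only in its edge, so that it can be replaced by its mirror
   image in that line. *)
Lemma open_sides_dodge d ds Q (A : set C) : is_digit d -> all is_digit ds ->
  A !=set0 -> A `<=` closed_cylinder (d :: ds) -> A `<=` off Q ->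
  exists d' ds', [/\ is_digit d', nrm d' = nrm d, all is_digit ds' &
    [/\ map nrm ds' = map nrm ds, open_sides Q d' &
    A `<=` closed_cylinder (d' :: ds')]].
Proof.
move=> hd hds [z0 Az0] Ac AQ.
have [[c [Qc c1 cd]]|nc] := pselect (exists c,
    [/\ Q c, sqnorm c = 1 & 0 < side c d]); last first.
  exists d, ds; split=> //; split=> // c Qc c1; rewrite leNgt; apply/negP => cd.
  by apply: nc; exists c.
(* [off Q] at the unit c' reads Re (c' / z) <= 1/2; subtract Re (c' d). *)
have sideA c' z : Q c' -> sqnorm c' = 1 -> A z ->
    Re (z^-1 - gauss R d) * c'.1%:~R - Im (z^-1 - gauss R d) * c'.2%:~R
      <= 2^-1 - (side c' d)%:~R.
  move=> Qc' c1' Az; have [_ z_n0 _] := Ac _ Az.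
  have := AQ _ Az _ Qc'; rewrite le_sqdist_unit// !reimE /=.
  by rewrite rmorphB !rmorphM /=; lra.
(* The square bounds the same quantity below by -1/2. *)
have side_le1 c' : Q c' -> sqnorm c' = 1 -> side c' d <= 1.
  move=> Qc' c1'; have := sideA _ _ Qc' c1' Az0; have [_ _ zd] := Ac _ Az0.
  have := side_ge c1' (closed_cylinder_square zd) => h1 h2.
  by rewrite -(ler_int R); lra.
have side1 : side c d = 1 by have := side_le1 _ Qc c1; lia.
have edge z : A z ->
    Re (z^-1 - gauss R d) * c.1%:~R - Im (z^-1 - gauss R d) * c.2%:~R = - 2^-1.
  move=> Az; have := sideA _ _ Qc c1 Az; have [_ _ zd] := Ac _ Az.
  by have := side_ge c1 (closed_cylinder_square zd); rewrite side1; lra.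
(* This is d - conj c, so Re (c d') = Re (c d) - |c|^2 = 0. *)
pose d' : int * int := (d.1 - c.1, d.2 + c.2).
(* Otherwise |d'|^2 = |d|^2 - 1 = 1, and 1/z0 lies outside the open unit disk at d'; but a point of
   the edge is within sqrt (1/2) of d'. *)
have hd' : is_digit d'.
  rewrite /is_digit leNgt; apply/negP => hlt.
  have d'1 : sqnorm d' = 1.
    move: hd hlt side1; rewrite /is_digit /d' /sqnorm /side /=.
    by case: (sqnorm1P c1) => -> /= *; nia.
  have [zF z_n0 zd] := Ac _ Az0; have := edge _ Az0.
  have := off_unit_inv zF z_n0 d'1; rewrite -[z0^-1](subrK (gauss R d)).
  case: (closed_cylinder_square zd); rewrite /sqdist !reimE /= => hx hy.
  rewrite rmorphB rmorphD /=.
  by case: (sqnorm1P c1) => -> /=; nra.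
(* c d and c d' differ only in their real parts, 1 and 0. The common imaginary part is at least 2 in
   absolute value, d' being a digit, and decides both max-norms. *)
have nd' : nrm d' = nrm d.
  move: hd' side1; rewrite /is_digit /d' /sqnorm /side /nrm /=.
  by case: (sqnorm1P c1) => -> /=; nia.
(* For c' = c or -c the side is 0. For the other two units it is the same as for d: at most 1, but
   at least 2 in absolute value, hence negative. *)
have sd' : open_sides Q d'.
  move=> c' Qc' c1'; have := side_le1 _ Qc' c1'.
  move: hd' side1; rewrite /is_digit /d' /sqnorm /side /=.
  by case: (sqnorm1P c1) => -> /=; case: (sqnorm1P c1') => -> /=; nia.
(* The reflection negates the real part if c is real, the imaginary part if c is imaginary. *)
have [ds' [n_ds' d_ds' c_ds']] :=
  closed_cylinder_flip R ds false (c.2 == 0) (c.1 == 0).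
exists d', ds'; split=> //; first by rewrite d_ds'.
split=> // z Az; have [zF z_n0 zd] := Ac _ Az; split=> //.
(* Adding conj c to 1/z - d turns Re (c (1/z - d)) = -1/2 into 1/2 and keeps the imaginary part of
   the product. *)
have -> : z^-1 - gauss R d' = flip false (c.2 == 0) (c.1 == 0) (z^-1 - gauss R d).
  have ez := edge _ Az.
  apply: complex_eq; move: ez; rewrite /flip !reimE /= (rmorphB, rmorphD) /=;
  by case: (sqnorm1P c1) => -> /= *; lra.
exact: c_ds'.
Qed.

Definition tile Q ds : set C := @open_cylinder R ds `&` @strictly_off R Q.

Lemma tile_cons Q d ds w : is_digit d -> ~ Q (0, 0) -> open_sides Q d ->
  tile (next_centers Q d) ds w -> tile Q (d :: ds) (w + gauss R d)^-1.
Proof.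
move=> hd Q0 hQ [wc wN]; have wF := open_cylinder_square wc.
have [zF zQ] := strictly_off_next hd Q0 hQ wF wN.
split=> //; split=> //.
  by rewrite invr_eq0; apply: gauss_add_neq0 hd (open_square_closed wF).
by rewrite invrK addrK.
Qed.

Lemma star_center_neq0 Q p : star_center Q p -> ~ Q (0, 0).
Proof.
move=> [[px py] pQ] /pQ[]; rewrite /sqdist /= => h _; move: h.
by rewrite !subr0; nra.
Qed.

(** All points of A must receive the same word, so the induction carries the whole set along z |->
    1/z - d'; the resulting closure is pulled back by the inverse map, which is continuous at the
    points needed. *)
Lemma closed_cylinder_tile ds Q p (A : set C) : all is_digit ds ->
  star_center Q p -> A !=set0 -> A `<=` closed_cylinder ds -> A `<=` off Q ->
  exists es, [/\ all is_digit es, map nrm es = map nrm ds &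
    A `<=` closure (tile Q es)].
Proof.
(* Induction on the length, since [open_sides_dodge] may change the tail. *)
move: {2}(size ds) (erefl (size ds)) => n.
elim: n ds Q p A => [|n IH] [|d ds] // Q p A.
  move=> _ _ pQ A0 Ac AQ; exists [::]; split=> // z Az.
  exact: star_closure pQ (Ac _ Az) (AQ _ Az).
move=> [szn] /andP[hd hds] pQ A0 Ac AQ.
have [d' [ds' [hd' nd' hds' [nds' sd' Ac']]]] :=
  open_sides_dodge hd hds A0 Ac AQ.
pose g (z : C) : C := z^-1 - gauss R d'.
have [z0 Az0] := A0.
have gA_off : g @` A `<=` off (next_centers Q d').
  move=> _ [z Az <-]; have [zF z_n0 _] := Ac' _ Az.
  exact: next_off zF z_n0 (AQ _ Az).
(* [g z0] lies in the closed square, hence inside the open unit disk at 0. *)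
have N0 : ~ next_centers Q d' (0, 0).
  have [hx hy] : closed_square (g z0).
    by have [_ _ /closed_cylinder_square] := Ac' _ Az0.
  move=> N0; have := gA_off _ (imageP g Az0) _ N0.
  by rewrite /sqdist /= !subr0; nra.
have gA_cyl : g @` A `<=` closed_cylinder ds'.
  by move=> _ [z Az <-]; have [] := Ac' _ Az.
have szn' : size ds' = n by rewrite -szn -(size_map nrm) nds' size_map.
have [es [hes nes ces]] := IH ds' _ _ _ szn' hds' (next_star_center R hd' N0)
  (image_nonempty g A0) gA_cyl gA_off.
exists (d' :: es); split=> /=; [by rewrite hd'|by rewrite nd' nes nds'|].
move=> z Az; have [_ z_n0 zd] := Ac' _ Az.
have zE : z = (g z + gauss R d')^-1 by rewrite subrK invrK.
have gz_n0 : g z + gauss R d' != 0 by rewrite subrK invr_eq0.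
rewrite zE; apply: (@closure_image R (fun w : C => (w + gauss R d')^-1)
  _ _ _ _ _ (ces _ (imageP g Az))).
  apply: (@continuousV _ _ (fun w : C => w + gauss R d')) => //.
  apply: (@continuousD _ _ _ (fun w : C => w) (fun=> gauss R d')).
    by move=> B.
  exact: (@cst_continuous C C (gauss R d') (g z)).
by move=> w; apply: tile_cons => //; exact: star_center_neq0 pQ.
Qed.

(** * Hurwitz quotients on closed and open cylinders *)

Lemma fundamental_domainP z : fundamental_domain z ->
  (- 2^-1 <= Re z < 2^-1) /\ (- 2^-1 <= Im z < 2^-1).
Proof.
move=> /(congr1 (fun w : C => (Re w, Im w))) /= [/eqP + /eqP].
rewrite !intr_eq0 !floor_eq /= => hx hy.
by split; lra.
Qed.

Lemma nearest_gauss d w : open_square w -> nearest (w + gauss R d) = gauss R d.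
Proof.
move=> [hx hy]; apply: complex_eq; rewrite /nearest /= !reimE /=; congr (_%:~R);
by apply: floor_def; rewrite rmorphD /=; lra.
Qed.

Lemma sub_nearest z : closed_square (z - nearest z).
Proof.
have := floor_itv (Re z + 2^-1); have := floor_itv (Im z + 2^-1).
by rewrite !rmorphD /= => hx hy; split; rewrite !reimE /=; lra.
Qed.

Lemma digits_gauss z : digits z ->
  exists d, is_digit d /\ z = gauss R d.
Proof.
move=> [/= /andP[/intrP[m mE] /intrP[k kE]] zn].
have zE : z = gauss R (m, k) by apply: complex_eq.
exists (m, k); split=> //; move: zn; rewrite zE lecE /= => /andP[_].
rewrite ler_sqrt ?addr_ge0 ?sqr_ge0// -(intr_sqnorm R (m, k)).
by rewrite -[2]/(2%:~R) ler_int.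
Qed.

Lemma gauss_digits d : is_digit d -> digits (gauss R d).
Proof.
move=> hd; split; first by rewrite /gaussian_integer /= !intr_int.
rewrite /= lecE /= eqxx /= ler_sqrt ?addr_ge0 ?sqr_ge0//.
by rewrite -intr_sqnorm -[2]/(2%:~R) ler_int.
Qed.

Lemma maxnorm_gauss d : maxnorm (gauss R d) = (nrm d)%:R.
Proof.
by rewrite /maxnorm /= -!intr_norm -!abszE -!pmulrn -natr_max maxEnat.
Qed.

Lemma partial_quotientS j z :
  partial_quotient j.+2 z = partial_quotient j.+1 (hurwitz_map z).
Proof. by rewrite /partial_quotient /= -iterSr. Qed.

Lemma nearest0 : nearest (0 : C) = 0.
Proof.
apply: complex_eq; rewrite /= add0r; apply/eqP; rewrite intr_eq0 floor_eq /=; lra.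
Qed.

Lemma closed_cylinder_quotients ds z : all is_digit ds -> closed_square z ->
  (forall j, (j < size ds)%N ->
    partial_quotient j.+1 z = gauss R (nth (0, 0) ds j)) ->
  closed_cylinder ds z.
Proof.
elim: ds z => [|d ds IH] z //= /andP[hd hds] zF zq.
have zd : nearest z^-1 = gauss R d := zq 0%N isT.
have z0 : z != 0.
  (* At z = 0 the quotient would be [0^-1] = [0] = 0, which is not a digit. *)
  apply/eqP => z0; move: zd; rewrite z0 invr0 nearest0 => /esym d0.
  have sq0 : closed_square (0 : C) by split; rewrite /=; lra.
  by have := gauss_add_neq0 hd sq0; rewrite d0 addr0 eqxx.
have zT : hurwitz_map z = z^-1 - gauss R d.
  by rewrite /hurwitz_map (negbTE z0) zd.
split=> //; apply: IH => //; first by rewrite -zd; exact: sub_nearest.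
by move=> j jds; rewrite -zT -partial_quotientS; exact: (zq j.+1).
Qed.

Lemma open_cylinder_quotients ds z : open_cylinder ds z ->
  forall j, (j < size ds)%N ->
    partial_quotient j.+1 z = gauss R (nth (0, 0) ds j).
Proof.
elim: ds z => [|d ds IH] z //= [zF z0 zd].
have zn : nearest z^-1 = gauss R d.
  by rewrite -[z^-1](subrK (gauss R d)) nearest_gauss//; exact: open_cylinder_square zd.
move=> [|j] jds //; rewrite partial_quotientS /hurwitz_map (negbTE z0) zn.
exact: IH.
Qed.

Lemma open_square_fundamental z : open_square z -> fundamental_domain z.
Proof.
move=> zF; have := @nearest_gauss (0, 0) z zF.
have -> : gauss R (0, 0) = 0 by [].
by rewrite addr0.
Qed.

End Words.

(** * Passage from the given cylinder to a regular one *)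

Theorem theorem6p1 (R : realType) (n : nat) (hn : (2 <= n)%N)
    (a : n.-tuple (Cplx R)) (ha : irregular a)
    (f : Cplx R -> Cplx R) (hf : Di8 f) :
  exists b : n.-tuple (Cplx R),
    [/\ regular b,
        f @` cylinder a `<=` closure (cylinder b)
      & forall j : 'I_n, maxnorm (tnth a j) = maxnorm (tnth b j)].
Proof.
have [aw [z0 az0] _] := ha.
have /choice[dig digP] j := digits_gauss (aw j).
pose ds := [seq dig j | j <- enum 'I_n].
have sds : size ds = n by rewrite size_map size_enum_ord.
have hds : all is_digit ds.
  by apply/allP => _ /mapP[j _ ->]; have [] := digP j.
have dsE j : nth (0, 0) ds (nat_of_ord j) = dig j.
  by rewrite (nth_map j) ?size_enum_ord// nth_ord_enum.
have cyl_a : cylinder a `<=` closed_cylinder ds.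
  move=> z [zF zq]; apply: closed_cylinder_quotients => //.
    by have := fundamental_domainP zF => -[? ?]; split; lra.
  move=> j; rewrite sds => jn; rewrite -[j]/(nat_of_ord (Ordinal jn)) dsE.
  by have [_ <-] := digP (Ordinal jn); rewrite -zq.
have [w [s [t fE]]] := Di8_flip hf.
have [ds' [nds' hds' cds']] := closed_cylinder_flip R ds w s t.
(* At the start no disk is removed from the square. *)
have c0 : star_center set0 (0 : Cplx R) by split=> //; split; rewrite /=; lra.
have fA : f @` cylinder a `<=` closed_cylinder ds'.
  by move=> _ [z az <-]; rewrite fE; apply/cds'/cyl_a.
rewrite hds in hds'.
have [es [hes nes ces]] := closed_cylinder_tile hds' c0
  (image_nonempty f (ex_intro _ z0 az0)) fA (fun _ _ _ => False_ind _).
have ses : size es = n by rewrite -(size_map nrm) nes nds' size_map.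
pose b : n.-tuple (Cplx R) := [tuple gauss R (nth (0, 0) es j) | j < n].
have open_b : open_cylinder es `<=` cylinder b.
  move=> z ez; split.
    exact/open_square_fundamental/open_cylinder_square/ez.
  by move=> j; rewrite tnth_mktuple (open_cylinder_quotients ez)// ses.
have cl_b : f @` cylinder a `<=` closure (cylinder b).
  apply: subset_trans ces _; apply: closure_subset.
  by move=> z [/open_b].
exists b; split=> //.
- split.
    move=> j; rewrite tnth_mktuple; apply/gauss_digits/(allP hes)/mem_nth.
    by rewrite ses.
  (* Testing a closure point against the whole plane yields a point of the tile; near it the open
     cylinder gives interior points of [cylinder b]. *)
  have [z [[ez _] _]] := ces _ (imageP f az0) _ filterT.
  by exists z; apply: filterS open_b (open_cylinder_nbhs ez).
- move=> j; have [_ ->] := digP j; rewrite tnth_mktuple !maxnorm_gauss -dsE.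
  congr (_%:R); rewrite -!(nth_map _ 0%N) ?ses ?sds//.
  by rewrite nes nds'.
Qed.
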